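(* For every integer $c\ge1$ there exists a constant $\alpha>0$ and infinitely many integers $N$ such that for each of them there is a 2D string $S\in\Sigma^{N\times N}$ and a 2D SLP $\mathcal G$ with $g$ nonterminals deriving $S$, such that every 2D SLP deriving $S$ either has depth at least $c\log N$ or has at least $\alpha\cdot g\cdot N/\log^{3}N$ nonterminals.
   Context: $\Sigma$ is a fixed finite alphabet (containing at least the symbols $0,1,\$$); logarithms are base 2. A 2D string of size $n\times m$ is an $n\times m$ array over $\Sigma$. A 2D SLP is a triple $(\mathcal V,\mathcal S,\rho)$ where $\mathcal V$ is a finite set of nonterminals each with a dimension (height, width), $\mathcal S\in\mathcal V$ is the start, and each production $\rho(X)$ is either a character $\sigma\in\Sigma$ ($X$ of size $1\times 1$), a horizontal concatenation $Y\oplus_{\mathrm h}Z$ of two nonterminals of the same height as $X$ (placing $Z$ to the right of $Y$; widths add), or a vertical concatenation $Y\oplus_{\mathrm v}Z$ of two nonterminals of the same width as $X$ (placing $Z$ below $Y$; heights add), with the occurrence relation acyclic. It derives the 2D string obtained by recursively expanding $\mathcal S$. Its depth is the depth of its derivation tree (rooted at $\mathcal S$, each node labeled $X$ having as children the symbols of $\rho(X)$). *)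

(* Defs.v *)
From mathcomp Require Import all_boot.
From Stdlib Require Import Reals.

Set Implicit Arguments.
Unset Strict Implicit.
Unset Printing Implicit Defensive.

(* A production rho(X) of a 2D SLP. Nonterminals are numbered 0..g-1 by a
   topological order of the (acyclic) occurrence relation: a concatenation
   rule of nonterminal k may only refer to nonterminals i, j < k.           *)
Inductive rule (Sigma : Type) : Type :=
  | Term of Sigma
  | HCat of nat & nat            (* X -> Y (+)_h Z : Z to the right of Y  *)
  | VCat of nat & nat.           (* X -> Y (+)_v Z : Z below Y            *)

(* A 2D SLP: the list of productions (one per nonterminal; the number of
   nonterminals is [size rules]) and the start nonterminal.                  *)
Record slp (Sigma : Type) : Type := SLP { rules : seq (rule Sigma); start : nat }.

(* A 2D string of height h and width w, given as (h, w, entries);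
   only entries (r, c) with r < h, c < w are meaningful. *)
Definition str2 (Sigma : Type) : Type := (nat * nat * (nat -> nat -> Sigma))%type.

Fixpoint expand_f (Sigma : Type) (rs : seq (rule Sigma)) (fuel k : nat)
  : option (str2 Sigma) :=
  match fuel with
  | 0 => None
  | f.+1 =>
    if k < size rs then
    match nth (HCat Sigma 0 0) rs k with
    | Term a => Some (1, 1, fun _ _ => a)
    | HCat i j =>
        if (i < k) && (j < k) then
        match expand_f rs f i, expand_f rs f j with
        | Some (h1, w1, A), Some (h2, w2, B) =>
            if h1 == h2 then
              Some (h1, w1 + w2, fun r c => if c < w1 then A r c else B r (c - w1))
            else None
        | _, _ => None
        end else None
    | VCat i j =>
        if (i < k) && (j < k) then
        match expand_f rs f i, expand_f rs f j with
        | Some (h1, w1, A), Some (h2, w2, B) =>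
            if w1 == w2 then
              Some (h1 + h2, w1, fun r c => if r < h1 then A r c else B (r - h1) c)
            else None
        | _, _ => None
        end else None
    end
    else None
  end.

(* Fuel k.+1 suffices since children have strictly smaller indices. *)
Definition expand (Sigma : Type) (rs : seq (rule Sigma)) (k : nat) :=
  expand_f rs k.+1 k.

(* Depth of the derivation tree rooted at nonterminal k: a terminal symbol
   is a leaf of depth 0, a nonterminal node has depth 1 + max of its
   children (so depth = number of edges of a longest root-to-leaf path). *)
Fixpoint depth_f (Sigma : Type) (rs : seq (rule Sigma)) (fuel k : nat) : nat :=
  match fuel with
  | 0 => 0
  | f.+1 =>
    match nth (HCat Sigma 0 0) rs k with
    | Term _ => 1
    | HCat i j | VCat i j => (maxn (depth_f rs f i) (depth_f rs f j)).+1
    end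
  end.

Definition slp_depth (Sigma : Type) (G : slp Sigma) : nat :=
  depth_f (rules G) (start G).+1 (start G).

Definition slp_size (Sigma : Type) (G : slp Sigma) : nat := size (rules G).

(* G is a valid 2D SLP: every nonterminal has a well-formed production
   (children precede it, dimensions match) and the start symbol exists. *)
Definition slp_wf (Sigma : Type) (G : slp Sigma) : Prop :=
  start G < size (rules G) /\
  forall k, k < size (rules G) -> expand (rules G) k <> None.

Definition derives (Sigma : Type) (G : slp Sigma) (n m : nat)
  (S : 'I_n -> 'I_m -> Sigma) : Prop :=
  slp_wf G /\
  exists A, expand (rules G) (start G) = Some (n, m, A) /\
            forall (i : 'I_n) (j : 'I_m), A i j = S i j.

Definition log2 (x : R) : R := (ln x / ln 2)%R.

(* Main.v *)
(** In every nonterminal of a 2D SLP the left column and the top row form a word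
  obtained from the words of its constituents by copying or concatenation; so if
  [m] distinct non-overlapping labels occur on such edges, the SLP has at least
  [m] nonterminals.

  Shearing a block that lists all [p]-bit numbers as columns gives a brick with a
  grammar of size O(p), [2^p * p.+1] rows, and exponentially many labels in each of
  its middle columns.  Rows of bricks and their transposes are used as the sides
  of concentric square frames, each new frame costing O(1) nonterminals.  Peeling
  the frames one by one derives the string with a tiny grammar.  Any other way of
  cutting it passes through the middle of a brick and creates an edge carrying
  [2^p.-1] labels; so a small grammar removes O(1) frames per level, and its depth
  is at least proportional to the number of frames, which is taken to be a large
  multiple of [log N]. *)

From Stdlib Require Import Reals Lra.
From mathcomp Require Import all_boot zify.
Require Import Defs.

Set Implicit Arguments.
Unset Strict Implicit.
Unset Printing Implicit Defensive.

(* mathcomp's zify rebinds [%R] to [ring_scope]. *)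
Delimit Scope R_scope with R.

(** * Concatenation, transposition and occurrences of two-dimensional strings *)

Section TwoDimensionalStrings.

Variable Sigma : Type.
Implicit Types (A B C : str2 Sigma) (rs : seq (rule Sigma)).

Definition hgt A : nat := A.1.1.
Definition wid A : nat := A.1.2.

Definition hcat A B : str2 Sigma :=
  (hgt A, wid A + wid B,
   fun r c => if c < wid A then A.2 r c else B.2 r (c - wid A)).

Definition vcat A B : str2 Sigma :=
  (hgt A + hgt B, wid A,
   fun r c => if r < hgt A then A.2 r c else B.2 (r - hgt A) c).

Definition tr A : str2 Sigma := (wid A, hgt A, fun r c => A.2 c r).

Definition cell (a : Sigma) : str2 Sigma := (1, 1, fun _ _ => a).

Lemma trK A : tr (tr A) = A.
Proof. by case: A => [[h w] f]. Qed.

Lemma hgt_hcat A B : hgt (hcat A B) = hgt A. Proof. by []. Qed.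
Lemma wid_hcat A B : wid (hcat A B) = wid A + wid B. Proof. by []. Qed.
Lemma hgt_vcat A B : hgt (vcat A B) = hgt A + hgt B. Proof. by []. Qed.
Lemma wid_vcat A B : wid (vcat A B) = wid A. Proof. by []. Qed.
Lemma hgt_tr A : hgt (tr A) = wid A. Proof. by []. Qed.
Lemma wid_tr A : wid (tr A) = hgt A. Proof. by []. Qed.
Lemma hgt_cell a : hgt (cell a) = 1. Proof. by []. Qed.
Lemma wid_cell a : wid (cell a) = 1. Proof. by []. Qed.
Definition dimE :=
  (hgt_hcat, wid_hcat, hgt_vcat, wid_vcat, hgt_tr, wid_tr, hgt_cell, wid_cell).

(** The number of copies is [n.+1], so no empty string is ever needed. *)
Fixpoint hpow A n : str2 Sigma :=
  if n is n'.+1 then hcat (hpow A n') A else A.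

Lemma hgt_hpow A n : hgt (hpow A n) = hgt A.
Proof. by elim: n. Qed.

Lemma wid_hpow A n : wid (hpow A n) = n.+1 * wid A.
Proof. by elim: n => [|n IH]; rewrite /= ?mul1n // dimE IH; lia. Qed.

Definition sub B A r c : Prop :=
  [/\ r + hgt B <= hgt A, c + wid B <= wid A &
      forall i j, i < hgt B -> j < wid B -> A.2 (r + i) (c + j) = B.2 i j].

Lemma sub_refl A : sub A A 0 0.
Proof. by split. Qed.

Lemma sub_trans A B C r c r' c' :
  sub C B r' c' -> sub B A r c -> sub C A (r + r') (c + c').
Proof.
move=> [h1 h2 h3] [k1 k2 k3]; split; [lia | lia | move=> i j hi hj].
by rewrite -h3 // -k3 -?addnA //; lia.
Qed.

Lemma sub_tr A B r c : sub B A r c -> sub (tr B) (tr A) c r.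
Proof. by case=> h1 h2 h3; split=> // i j hi hj; rewrite /= h3. Qed.

Lemma sub_hcatl A B : sub A (hcat A B) 0 0.
Proof.
split=> [||i j hi hj]; rewrite ?dimE ?leq_addr //.
by rewrite /= !add0n hj.
Qed.

Lemma sub_hcatr A B : hgt A = hgt B -> sub B (hcat A B) 0 (wid A).
Proof.
move=> e; split=> [||i j hi hj]; rewrite ?dimE ?e //.
by rewrite /= ltnNge leq_addr /= addKn.
Qed.

Lemma sub_vcatl A B : sub A (vcat A B) 0 0.
Proof. exact: sub_tr (sub_hcatl (tr A) (tr B)). Qed.

Lemma sub_vcatr A B : wid A = wid B -> sub B (vcat A B) (hgt A) 0.
Proof.
move=> e; have := sub_tr (@sub_hcatr (tr A) (tr B) e).
by rewrite trK.
Qed.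

Lemma sub_hpow A n m : m <= n -> sub A (hpow A n) 0 (m * wid A).
Proof.
elim: n => [|n IH]; first by rewrite leqn0 => /eqP ->; exact: sub_refl.
rewrite leq_eqVlt => /orP [/eqP -> | /IH h].
  by rewrite -wid_hpow; apply: sub_hcatr; rewrite hgt_hpow.
exact: sub_trans h (sub_hcatl _ _).
Qed.

(** * Expansion of nonterminals, and grammars extended rule by rule *)

Lemma expand_f_fuel rs f k : k < f -> expand_f rs f k = expand rs k.
Proof.
suff h : forall f g k, k < f -> k < g -> expand_f rs f k = expand_f rs g k.
  by move=> kf; apply: h.
elim=> [//|f' IH] [//|g] k' kf kg /=.
case: ifP => // _; case: nth => // i j; case: ifP => // /andP [ik jk];
  by rewrite (IH g i) ?(IH g j) //; lia.
Qed.

Lemma expand_unfold rs k : expand rs k =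
  if k < size rs then
    match nth (HCat Sigma 0 0) rs k with
    | Term a => Some (cell a)
    | HCat i j =>
      if (i < k) && (j < k) then
        match expand rs i, expand rs j with
        | Some A, Some B => if hgt A == hgt B then Some (hcat A B) else None
        | _, _ => None
        end else None
    | VCat i j =>
      if (i < k) && (j < k) then
        match expand rs i, expand rs j with
        | Some A, Some B => if wid A == wid B then Some (vcat A B) else None
        | _, _ => None
        end else None
    end
  else None.
Proof.
rewrite {1}/expand /=; case: ifP => // _; case: nth => // i j;
  case: ifP => // /andP [ik jk]; rewrite !expand_f_fuel //;
  by case: (expand rs i) => // [[[h1 w1] A]]; case: (expand rs j) => // [[[h2 w2] B]].
Qed.

(** Rules refer only to smaller indices, so a rule appended at the end cannot affect earlier
    nonterminals. *)
Lemma expand_rcons rs x k : k < size rs -> expand (rcons rs x) k = expand rs k.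
Proof.
elim/ltn_ind: k => k IH kl; rewrite (expand_unfold (rcons _ _)) expand_unfold.
rewrite nth_rcons size_rcons kl ltnS (ltnW kl).
by case: nth => // i j; case: ifP => // /andP [ik jk]; rewrite !IH //; lia.
Qed.

Definition valid rs := forall k, k < size rs -> expand rs k <> None.

Lemma valid_rcons rs x A :
  valid rs -> expand (rcons rs x) (size rs) = Some A -> valid (rcons rs x).
Proof.
move=> v e k; rewrite size_rcons ltnS leq_eqVlt => /orP [/eqP ->|kl]; first by rewrite e.
by rewrite expand_rcons //; apply: v.
Qed.

Definition derivable rs A := exists2 k, k < size rs & expand rs k = Some A.

Lemma derivable_rcons rs x A : derivable rs A -> derivable (rcons rs x) A.
Proof.
case=> k kl e; exists k; first by rewrite size_rcons ltnS ltnW.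
by rewrite expand_rcons.
Qed.

Lemma add_rule rs x A : valid rs -> expand (rcons rs x) (size rs) = Some A ->
  valid (rcons rs x) /\ derivable (rcons rs x) A.
Proof.
move=> v e; split; first exact: valid_rcons e.
by exists (size rs); rewrite // size_rcons.
Qed.

Lemma add_cell rs a : valid rs ->
  exists x, valid (rcons rs x) /\ derivable (rcons rs x) (cell a).
Proof.
move=> v; exists (Term a); apply: add_rule => //.
by rewrite expand_unfold size_rcons ltnSn nth_rcons ltnn eqxx.
Qed.

Lemma add_hcat rs A B : valid rs -> derivable rs A -> derivable rs B ->
  hgt A = hgt B ->
  exists x, valid (rcons rs x) /\ derivable (rcons rs x) (hcat A B).
Proof.
move=> v [i il ei] [j jl ej] e; exists (HCat _ i j); apply: add_rule => //.
rewrite expand_unfold size_rcons ltnSn nth_rcons ltnn eqxx il jl /=.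
by rewrite !expand_rcons // ei ej e eqxx.
Qed.

Lemma add_vcat rs A B : valid rs -> derivable rs A -> derivable rs B ->
  wid A = wid B ->
  exists x, valid (rcons rs x) /\ derivable (rcons rs x) (vcat A B).
Proof.
move=> v [i il ei] [j jl ej] e; exists (VCat _ i j); apply: add_rule => //.
rewrite expand_unfold size_rcons ltnSn nth_rcons ltnn eqxx il jl /=.
by rewrite !expand_rcons // ei ej e eqxx.
Qed.

(* Requiring the transposes as well keeps [gen] closed under [tr], at the price
   of two rules per concatenation. *)
Definition gen n (l : seq (str2 Sigma)) : Prop :=
  exists rs, [/\ valid rs, size rs <= n &
    forall A, List.In A l -> derivable rs A /\ derivable rs (tr A)].

Lemma gen_nil : gen 0 [::].
Proof. by exists [::]; split. Qed.

Lemma gen_sub n n' l l' :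
  gen n l -> n <= n' -> (forall A, List.In A l' -> List.In A l) -> gen n' l'.
Proof.
move=> [rs [v s h]] nn ll; exists rs; split=> //; first exact: leq_trans nn.
by move=> A /ll /h.
Qed.

Lemma gen_tr n l A : gen n l -> List.In A l -> gen n (tr A :: l).
Proof.
move=> [rs [v s h]] Al; exists rs; split=> // B [<-|/h //].
by rewrite trK; case: (h _ Al).
Qed.

Lemma gen_cell n l a : gen n l -> gen n.+1 (cell a :: l).
Proof.
move=> [rs [v s h]]; have [x [v' d]] := add_cell a v.
exists (rcons rs x); split=> //; first by rewrite size_rcons.
by move=> A [<- //|/h [d1 d2]]; split; apply: derivable_rcons.
Qed.

Lemma gen_hcat n l A B : gen n l -> List.In A l -> List.In B l ->
  hgt A = hgt B -> gen n.+2 (hcat A B :: l).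
Proof.
move=> [rs [v s h]] /h [a a'] /h [b b'] e.
have [x [v1 d1]] := add_hcat v a b e.
have [y [v2 d2]] := add_vcat v1 (derivable_rcons x a') (derivable_rcons x b') e.
exists (rcons (rcons rs x) y); split=> //; first by rewrite !size_rcons.
move=> C [<-|/h [c c']]; last by split; do 2!apply: derivable_rcons.
by split; [apply: derivable_rcons | exact: d2].
Qed.

(** Transposition turns this into [gen_hcat] for [tr A] and [tr B], whose two rules already yield
    both the string and its transpose. *)
Lemma gen_vcat n l A B : gen n l -> List.In A l -> List.In B l ->
  wid A = wid B -> gen n.+2 (vcat A B :: l).
Proof.
move=> g Al Bl e.
have g1 := gen_tr (gen_tr g Al) (or_intror Bl : List.In B (tr A :: l)).
have g2 := @gen_hcat _ _ (tr A) (tr B) g1 (or_intror (or_introl erefl)) (or_introl erefl) e.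
have := gen_tr g2 (or_introl erefl).
rewrite -[A in vcat A]trK -[B in vcat _ B]trK => g3.
apply: gen_sub g3 (leqnn _) _ => C /= [<-|]; [by left | by tauto].
Qed.

Lemma gen_hpow n l A m : gen n l -> List.In A l -> gen (n + 2 * m) (hpow A m :: l).
Proof.
move=> g Al; elim: m => [|m IH].
  by apply: gen_sub g _ _ => [|B /= [<-|]]; rewrite ?muln0 ?addn0.
have -> : n + 2 * m.+1 = (n + 2 * m).+2 by lia.
have g1 := gen_hcat IH (or_introl erefl) (or_intror Al) (hgt_hpow A m).
by apply: gen_sub g1 (leqnn _) _ => B /=; tauto.
Qed.

End TwoDimensionalStrings.

(** * Labels on the edges of nonterminals *)

Section EdgeLabels.

Variable Sigma : Type.
Implicit Types (A B C : str2 Sigma) (rs : seq (rule Sigma)).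

(* [f k] is a word of length [len k] obtained from earlier words by copying or by
   concatenation at [cut k].  Only [lab v 0] equals [sd], so two occurrences of
   labels cannot overlap and at most one label straddles a given cut. *)
Lemma labels_le_words (sd : Sigma) (n L m v0 : nat) (len cut : nat -> nat)
    (f lab : nat -> nat -> Sigma) :
  1 < L ->
  (forall k, k < n ->
    [\/ len k = 1,
        exists i, [/\ i < k, len k = len i & forall r, f k r = f i r] |
        exists i j, [/\ i < k, j < k, len k = len i + len j, cut k = len i &
          forall r, f k r = if r < len i then f i r else f j (r - len i)]]) ->
  (forall v, v0 <= v < v0 + m -> lab v 0 = sd) ->
  (forall v u, v0 <= v < v0 + m -> 0 < u < L -> lab v u <> sd) ->
  (forall v v', v0 <= v < v0 + m -> v0 <= v' < v0 + m ->
     (forall u, u < L -> lab v u = lab v' u) -> v = v') ->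
  (forall v, v0 <= v < v0 + m -> exists k r,
     [/\ k < n, r + L <= len k & forall u, u < L -> f k (r + u) = lab v u]) ->
  m <= n.
Proof.
move=> L1 words labsd labn labinj occ.
pose straddles v k := exists r, r < cut k < r + L /\
  forall u, u < L -> f k (r + u) = lab v u.
(* Descend to earlier words as long as the occurrence lies on one side of the cut. Words of length 1
   are too short to contain a label, so the descent ends at a straddled cut. *)
have P v : v0 <= v < v0 + m -> exists2 k, k < n & straddles v k.
  move=> /occ [k]; elim/ltn_ind: k => k IH [r [kn rL fl]].
  case: (words k kn) => [l1|[i [ik li fi]]|[i [j [ik jk lk ck fk]]]].
  - by lia.
  - by apply: (IH i ik); exists r; split=> [||u uL]; rewrite -?li -?fi ?fl //; lia.
  - have [ri|ri] := leqP (r + L) (len i).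
      apply: (IH i ik); exists r; split=> [||u uL] //; first by lia.
      by rewrite -fl // fk ifT //; lia.
    have [rj|rj] := leqP (len i) r.
      apply: (IH j jk); exists (r - len i); split=> [||u uL]; try by lia.
      rewrite -fl // fk ifF; last by lia.
      by congr f; lia.
    by exists k => //; exists r; rewrite ck ri rj.
have {}P (v : 'I_m) : exists k : 'I_n, straddles (v0 + v) k.
  have [|k kn s] := P (v0 + v); first by have := ltn_ord v; lia.
  by exists (Ordinal kn).
have [g gP] := fin_all_exists P.
(* Pigeonhole: it suffices that no cut is straddled by two different labels. *)
suff ginj : injective g by have := leq_card g ginj; rewrite !card_ord.
move=> v v' gv; have [r [c1 e1]] := gP v; have [r' [c2 e2]] := gP v'.
rewrite -gv in c2 e2.
have hv : v0 <= v0 + v < v0 + m by have := ltn_ord v; lia.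
have hv' : v0 <= v0 + v' < v0 + m by have := ltn_ord v'; lia.
(* Both occurrences straddle the same cut, so they overlap. With different starting points, the head
   [sd] of the later one would be a non-head symbol of the earlier one. *)
have [rr|rr|rr] := ltngtP r r'.
- case: (@labn (v0 + v) (r' - r)) => //; first by lia.
  by rewrite -(labsd _ hv') -e1 -?e2; [congr f | |]; lia.
- case: (@labn (v0 + v') (r - r')) => //; first by lia.
  by rewrite -(labsd _ hv) -e1 -?e2; [congr f | |]; lia.
apply/val_inj/(@addnI v0)/labinj => // u uL.
by rewrite -e1 // -e2 // rr.
Qed.

Variant expand_spec rs k A : Prop :=
| ExpandTerm a of nth (HCat Sigma 0 0) rs k = Term a & A = cell a
| ExpandHCat i j B C of nth (HCat Sigma 0 0) rs k = HCat Sigma i j &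
    i < k & j < k & expand rs i = Some B & expand rs j = Some C &
    hgt B = hgt C & A = hcat B C
| ExpandVCat i j B C of nth (HCat Sigma 0 0) rs k = VCat Sigma i j &
    i < k & j < k & expand rs i = Some B & expand rs j = Some C &
    wid B = wid C & A = vcat B C.

Lemma expandP rs k A : expand rs k = Some A -> expand_spec rs k A.
Proof.
rewrite expand_unfold; case: ifP => // _.
case e: (nth _ _ _) => [a|i j|i j]; first by case=> <-; apply: (ExpandTerm e).
  case: ifP => // /andP [ik jk].
  case ei: (expand rs i) => [B|] //; case ej: (expand rs j) => [C|] //.
  by case: eqP => // h [<-]; apply: (ExpandHCat e ik jk ei ej).
case: ifP => // /andP [ik jk].
case ei: (expand rs i) => [B|] //; case ej: (expand rs j) => [C|] //.
by case: eqP => // h [<-]; apply: (ExpandVCat e ik jk ei ej).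
Qed.

(** Positive width makes the left column of a horizontal concatenation that of its left part;
    positive height does the same for top rows. *)
Lemma expand_gt0 rs k A : expand rs k = Some A -> (0 < hgt A) && (0 < wid A).
Proof.
elim/ltn_ind: k A => k IH A /expandP [a _ -> //|i j B C _ ik jk ei ej e ->|i j B C _ ik jk ei ej e ->];
 have := IH _ ik _ ei; have := IH _ jk _ ej; rewrite !dimE; lia.
Qed.

Variables (sd : Sigma) (L m v0 : nat) (lab : nat -> nat -> Sigma).
Hypothesis L1 : 1 < L.
Hypothesis lab_head : forall v, v0 <= v < v0 + m -> lab v 0 = sd.
Hypothesis lab_tail : forall v u, v0 <= v < v0 + m -> 0 < u < L -> lab v u <> sd.
Hypothesis lab_inj : forall v v', v0 <= v < v0 + m -> v0 <= v' < v0 + m ->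
  (forall u, u < L -> lab v u = lab v' u) -> v = v'.

Definition has_label A y v :=
  exists2 r, r + L <= hgt A & forall u, u < L -> A.2 (r + u) y = lab v u.

Lemma left_labels_le_size rs : valid rs ->
  (forall v, v0 <= v < v0 + m ->
     exists k A, [/\ k < size rs, expand rs k = Some A & has_label A 0 v]) ->
  m <= size rs.
Proof.
move=> val occ; pose str k := odflt (cell sd) (expand rs k).
apply: (@labels_le_words sd _ L m v0 (fun k => hgt (str k))
  (fun k => if nth (HCat Sigma 0 0) rs k is VCat i _ then hgt (str i) else 0)
  (fun k r => (str k).2 r 0) lab) => //.
- move=> k kn; case ek: (expand rs k) => [A|]; last by case: (val k kn).
  have sk : str k = A by rewrite /str ek.
  case: (expandP ek) => [a _ eA|i j B C _ ik jk ei ej e eA|i j B C -> ik jk ei ej e eA].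
  + by apply: Or31; rewrite sk eA.
  + apply: Or32; exists i; rewrite sk /str ei eA /=; split=> // r.
    by have /andP [_ ->] := expand_gt0 ei.
  + apply: Or33; exists i, j; rewrite sk /str ei ej eA /=; split=> //.
- move=> v /occ [k [A [kn ek [r rL h]]]]; exists k, r; rewrite /str ek; split=> //.
Qed.

Lemma top_labels_le_size rs : valid rs ->
  (forall v, v0 <= v < v0 + m ->
     exists k A, [/\ k < size rs, expand rs k = Some A & has_label (tr A) 0 v]) ->
  m <= size rs.
Proof.
move=> val occ; pose str k := odflt (cell sd) (expand rs k).
apply: (@labels_le_words sd _ L m v0 (fun k => wid (str k))
  (fun k => if nth (HCat Sigma 0 0) rs k is HCat i _ then wid (str i) else 0)
  (fun k r => (str k).2 0 r) lab) => //.
- move=> k kn; case ek: (expand rs k) => [A|]; last by case: (val k kn).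
  have sk : str k = A by rewrite /str ek.
  case: (expandP ek) => [a _ eA|i j B C -> ik jk ei ej e eA|i j B C _ ik jk ei ej e eA].
  + by apply: Or31; rewrite sk eA.
  + by apply: Or33; exists i, j; rewrite sk /str ei ej eA /=; split.
  + apply: Or32; exists i; rewrite sk /str ei eA /=; split=> // r.
    by have /andP [-> _] := expand_gt0 ei.
- move=> v /occ [k [A [kn ek [r rL h]]]]; exists k, r; rewrite /str ek; split=> //.
Qed.

End EdgeLabels.

(** * Bricks, strips and nested frames *)

Section Construction.

Variables (Sigma : Type) (s0 s1 sd : Sigma).
Hypotheses (s01 : s0 <> s1) (s0d : s0 <> sd) (s1d : s1 <> sd).

Fixpoint row_of (a : Sigma) p : str2 Sigma :=
  if p is p'.+1 then hcat (row_of a p') (row_of a p') else cell a.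

(* Column [v] of [labels p] is [sd] followed by the [p] binary digits of [v]. *)
Fixpoint labels p : str2 Sigma :=
  if p is p'.+1 then
    hcat (vcat (labels p') (row_of s0 p')) (vcat (labels p') (row_of s1 p'))
  else cell sd.

Fixpoint pad_col p : str2 Sigma :=
  if p is p'.+1 then vcat (pad_col p') (cell s0) else cell s0.

(** Filler with the height of [shear p j] and the width by which the lower half of [shear p j.+1] is
    shifted. *)
Fixpoint pad p j : str2 Sigma :=
  if j is j'.+1 then
    vcat (hcat (pad p j') (pad p j')) (hcat (pad p j') (pad p j'))
  else pad_col p.

(* [shear p j] stacks [2 ^ j] copies of [labels p], each shifted by one column
   with respect to the copy above it. *)
Fixpoint shear p j : str2 Sigma :=
  if j is j'.+1 then
    vcat (hcat (shear p j') (pad p j')) (hcat (pad p j') (shear p j'))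
  else hcat (labels p) (pad_col p).

Definition brick p := shear p p.

(** A group of [p.+1] bricks is twice as wide as it is high, which is exactly how much the side of a
    square grows when a frame is added around it. *)
Definition strip p j := hpow (hpow (brick p) p) j.

Lemma stripE p j : strip p j = hpow (hpow (brick p) p) j. Proof. by []. Qed.

Lemma stripS p j : strip p j.+1 = hcat (strip p j) (hpow (brick p) p).
Proof. by []. Qed.

(** The horizontal strips span the full side and the transposed ones fit between them. The core is a
    constant square of side [2 * thickness p]. *)
Fixpoint nest p j : str2 Sigma :=
  if j is j'.+1 then
    vcat (vcat (strip p j'.+1)
               (hcat (hcat (tr (strip p j')) (nest p j')) (tr (strip p j'))))
         (strip p j'.+1)
  else hpow (pad p p.+1) p.

(** * Dimensions of the blocks *)

Lemma dim_row_of a p : hgt (row_of a p) = 1 /\ wid (row_of a p) = 2 ^ p.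
Proof. by elim: p => //= p [h w]; rewrite !dimE h w expnS; split; lia. Qed.

Lemma dim_labels p : hgt (labels p) = p.+1 /\ wid (labels p) = 2 ^ p.
Proof.
elim: p => //= p [h w]; rewrite !dimE h w (dim_row_of _ p).1 expnS.
by split; lia.
Qed.

Lemma dim_pad_col p : hgt (pad_col p) = p.+1 /\ wid (pad_col p) = 1.
Proof. by elim: p => //= p [h w]; rewrite !dimE h w /hgt /=; split; lia. Qed.

Lemma dim_pad p j : hgt (pad p j) = 2 ^ j * p.+1 /\ wid (pad p j) = 2 ^ j.
Proof.
elim: j => [|j [h w]] /=; first by rewrite mul1n; exact: dim_pad_col.
by rewrite !dimE h w expnS; split; lia.
Qed.

Lemma dim_shear p j :
  hgt (shear p j) = 2 ^ j * p.+1 /\ wid (shear p j) = 2 ^ p + 2 ^ j.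
Proof.
elim: j => [|j [h w]] /=.
  by rewrite !dimE (dim_labels p).1 (dim_labels p).2 (dim_pad_col p).2 mul1n.
by rewrite !dimE h w (dim_pad p j).1 (dim_pad p j).2 expnS; split; lia.
Qed.

Definition thickness p := 2 ^ p * p.+1.

Lemma dim_brick p : hgt (brick p) = thickness p /\ wid (brick p) = 2 * 2 ^ p.
Proof. by rewrite /brick (dim_shear p p).1 (dim_shear p p).2; split; rewrite // mul2n addnn. Qed.

Lemma dim_strip p j :
  hgt (strip p j) = thickness p /\ wid (strip p j) = 2 * j.+1 * thickness p.
Proof.
rewrite stripE !hgt_hpow !wid_hpow (dim_brick p).1 (dim_brick p).2.
by rewrite /thickness; split=> //; move: (2 ^ p) => e; nia.
Qed.

Lemma dim_nest p j : hgt (nest p j) = 2 * j.+1 * thickness p /\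
  wid (nest p j) = 2 * j.+1 * thickness p.
Proof.
elim: j => [|j [h w]].
  rewrite /nest hgt_hpow wid_hpow (dim_pad _ _).1 (dim_pad _ _).2 expnS.
  by rewrite /thickness; split=> //; move: (2 ^ p) => e; nia.
have [h0 w0] := dim_strip p j; have [h1 w1] := dim_strip p j.+1.
rewrite [nest _ _]/=; move: (strip p j.+1) h1 w1 => S h1 w1.
by rewrite !dimE h1 w1 w0; split=> //; lia.
Qed.

(** * Grammar sizes *)

(** Three rules give the cells; each level then takes six concatenations at two rules each. *)
Lemma gen_labels p :
  gen (3 + 12 * p) [:: labels p; row_of s0 p; row_of s1 p; pad_col p; cell s0].
Proof.
elim: p => [|p IH].
  have g := gen_cell sd (gen_cell s1 (gen_cell s0 (gen_nil Sigma))).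
  by apply: gen_sub g _ _ => // A /=; tauto.
have e0 := dim_row_of s0 p; have e1 := dim_row_of s1 p; have eq := dim_labels p.
have g1 := @gen_vcat _ _ _ (labels p) (row_of s0 p) IH.
have {}g1 := g1 ltac:(simpl; tauto) ltac:(simpl; tauto) ltac:(lia).
have g2 := @gen_vcat _ _ _ (labels p) (row_of s1 p) g1.
have {}g2 := g2 ltac:(simpl; tauto) ltac:(simpl; tauto) ltac:(lia).
have g3 := @gen_hcat _ _ _ (vcat (labels p) (row_of s0 p)) (vcat (labels p) (row_of s1 p)) g2.
have {}g3 := g3 ltac:(simpl; tauto) ltac:(simpl; tauto) ltac:(rewrite !dimE; lia).
have g4 := @gen_hcat _ _ _ (row_of s0 p) (row_of s0 p) g3.
have {}g4 := g4 ltac:(simpl; tauto) ltac:(simpl; tauto) erefl.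
have g5 := @gen_hcat _ _ _ (row_of s1 p) (row_of s1 p) g4.
have {}g5 := g5 ltac:(simpl; tauto) ltac:(simpl; tauto) erefl.
have g6 := @gen_vcat _ _ _ (pad_col p) (cell s0) g5.
have {}g6 := g6 ltac:(simpl; tauto) ltac:(simpl; tauto) (dim_pad_col p).2.
by apply: gen_sub g6 _ _ => [|A /=]; [lia | tauto].
Qed.

Lemma gen_pad n l p j : gen n l -> List.In (pad p j) l ->
  gen n.+4 (pad p j.+1 :: l).
Proof.
move=> g inl; have g1 := gen_hcat g inl inl erefl.
have g2 := gen_vcat g1 (or_introl erefl) (or_introl erefl) erefl.
by apply: gen_sub g2 _ _ => // A /=; tauto.
Qed.

Lemma gen_shear p j : gen (5 + 12 * p + 10 * j) [:: shear p j; pad p j].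
Proof.
elim: j => [|j IH].
  have g := @gen_hcat _ _ _ (labels p) (pad_col p) (gen_labels p).
  have {}g := g ltac:(simpl; tauto) ltac:(simpl; tauto) ltac:(by rewrite (dim_labels p).1 (dim_pad_col p).1).
  by apply: gen_sub g _ _ => [|A /=]; [lia | tauto].
have eh : hgt (shear p j) = hgt (pad p j) by rewrite (dim_shear p j).1 (dim_pad p j).1.
have g1 := @gen_hcat _ _ _ (shear p j) (pad p j) IH.
have {}g1 := g1 ltac:(simpl; tauto) ltac:(simpl; tauto) eh.
have g2 := @gen_hcat _ _ _ (pad p j) (shear p j) g1.
have {}g2 := g2 ltac:(simpl; tauto) ltac:(simpl; tauto) (esym eh).
have g3 := @gen_vcat _ _ _ (hcat (shear p j) (pad p j)) (hcat (pad p j) (shear p j)) g2.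
have {}g3 := g3 ltac:(simpl; tauto) ltac:(simpl; tauto) ltac:(rewrite !dimE; lia).
have g4 := @gen_pad _ _ p j g3 ltac:(simpl; tauto).
by apply: gen_sub g4 _ _ => [|A /=]; [lia | tauto].
Qed.

(** Each frame takes five concatenations regardless of its length: the new strip extends the
    previous one by a single group of bricks, and transposes are free. *)
Lemma gen_nest p j :
  gen (9 + 26 * p + 10 * j) [:: nest p j; strip p j; hpow (brick p) p].
Proof.
elim: j => [|j IH].
  have g1 := @gen_pad _ _ p p (gen_shear p p) ltac:(simpl; tauto).
  have g2 := @gen_hpow _ _ _ (pad p p.+1) p g1 ltac:(simpl; tauto).
  have g3 := @gen_hpow _ _ _ (brick p) p g2 ltac:(simpl; tauto).
  by apply: gen_sub g3 _ _ => [|A /=]; [lia | rewrite stripE /=; tauto].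
have [h0 w0] := dim_strip p j; have [h1 w1] := dim_strip p j.+1.
have [hn wn] := dim_nest p j.
have g1 := @gen_hcat _ _ _ (strip p j) (hpow (brick p) p) IH.
have {}g1 := g1 ltac:(simpl; tauto) ltac:(simpl; tauto) ltac:(rewrite stripE !hgt_hpow //).
rewrite -stripS in g1.
have g2 := @gen_tr _ _ _ (strip p j) g1 ltac:(simpl; tauto).
have g3 := @gen_hcat _ _ _ (tr (strip p j)) (nest p j) g2.
have {}g3 := g3 ltac:(simpl; tauto) ltac:(simpl; tauto) ltac:(rewrite !dimE; lia).
have g4 := @gen_hcat _ _ _ (hcat (tr (strip p j)) (nest p j)) (tr (strip p j)) g3.
have {}g4 := g4 ltac:(simpl; tauto) ltac:(simpl; tauto) ltac:(rewrite !dimE; lia).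
have g5 := @gen_vcat _ _ _ (strip p j.+1)
  (hcat (hcat (tr (strip p j)) (nest p j)) (tr (strip p j))) g4.
have {}g5 := g5 ltac:(simpl; tauto) ltac:(simpl; tauto) ltac:(rewrite w1 !dimE; lia).
have g6 := @gen_vcat _ _ _ (vcat (strip p j.+1)
  (hcat (hcat (tr (strip p j)) (nest p j)) (tr (strip p j)))) (strip p j.+1) g5.
have {}g6 := g6 ltac:(simpl; tauto) ltac:(simpl; tauto) ltac:(by []).
by apply: gen_sub g6 _ _ => [|A /=]; [lia | tauto].
Qed.

(** * Labels met by the columns of bricks, strips and nests *)

Lemma row_ofE a p u v : (row_of a p).2 u v = a.
Proof. by elim: p u v => //= p IH u v; case: ifP; rewrite IH. Qed.

Lemma labels_head p v : v < 2 ^ p -> (labels p).2 0 v = sd.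
Proof.
elim: p v => //= p IH v; rewrite expnS !dimE (dim_labels p).1 (dim_labels p).2 /= => vp.
by case: ifP => [/IH //|h]; apply: IH; lia.
Qed.

Lemma labels_tail p u v : v < 2 ^ p -> 0 < u < p.+1 -> (labels p).2 u v <> sd.
Proof.
elim: p u v => /= [u v|p IH u v]; first by lia.
rewrite expnS !dimE (dim_labels p).1 (dim_labels p).2 !row_ofE /= => vp up.
by case: ifP => h1; case: ifP => // h2; apply: IH; lia.
Qed.

Lemma labels_inj p v v' : v < 2 ^ p -> v' < 2 ^ p ->
  (forall u, u < p.+1 -> (labels p).2 u v = (labels p).2 u v') -> v = v'.
Proof.
elim: p v v' => [|p IH] v v'; first by lia.
rewrite expnS => vp vp' h.
have hu u : u < p.+1 -> (labels p.+1).2 u v =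
    (labels p).2 u (if v < 2 ^ p then v else v - 2 ^ p).
  by rewrite /= !dimE (dim_labels p).1 (dim_labels p).2 => ->; case: ifP.
have hu' u : u < p.+1 -> (labels p.+1).2 u v' =
    (labels p).2 u (if v' < 2 ^ p then v' else v' - 2 ^ p).
  by rewrite /= !dimE (dim_labels p).1 (dim_labels p).2 => ->; case: ifP.
have {hu hu'} := IH (if v < 2 ^ p then v else v - 2 ^ p)
  (if v' < 2 ^ p then v' else v' - 2 ^ p) ltac:(case: ifP; lia) ltac:(case: ifP; lia)
  (fun u up => etrans (esym (hu u up)) (etrans (h u (ltnW up)) (hu' u up))).
(* The earlier rows fix the position within a half; this last row tells the left half ([s0]) from
   the right half ([s1]). *)
have := h p.+1 (ltnSn _).
rewrite /= !dimE (dim_labels p).1 (dim_labels p).2 !row_ofE ltnn.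
by case: ifP => h1; case: ifP => h2 // e; [case: s01 | lia].
Qed.

(** Passing to the lower half adds [2 ^ j] both to the copy number and to the column shift. Hence a
    fixed column meets a different label in each copy that it crosses. *)
Lemma sub_labels_shear p j i : i < 2 ^ j -> sub (labels p) (shear p j) (i * p.+1) i.
Proof.
have lp := dim_labels p; have cp := dim_pad_col p.
elim: j i => [|j IH] i /=.
  by rewrite expn0 ltnS leqn0 => /eqP ->; apply: sub_hcatl.
have [ph pw] := dim_pad p j; have [sh sw] := dim_shear p j.
rewrite expnS => ij; have [il|il] := ltnP i (2 ^ j).
  rewrite -[i * _]add0n -[X in sub _ _ _ X]add0n.
  apply: sub_trans (IH _ il) _.
  by have := sub_trans (sub_hcatl (shear p j) (pad p j)) (sub_vcatl _ _); apply.
have {}IH := IH (i - 2 ^ j) ltac:(lia).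
have s1' := @sub_hcatr _ (pad p j) (shear p j) ltac:(lia).
have s2' := @sub_vcatr _ (hcat (shear p j) (pad p j)) (hcat (pad p j) (shear p j))
  ltac:(rewrite !dimE; lia).
have := sub_trans IH (sub_trans s1' s2').
rewrite !dimE sh pw; congr sub; last by lia.
by move: (2 ^ j) il => e il; nia.
Qed.

(** Half of all labels, in an interval that may depend on the column, is what every middle column of
    a brick can offer. *)
Definition hard_col p A y := exists2 v0, v0 + 2 ^ p.-1 <= 2 ^ p &
  forall v, v0 <= v < v0 + 2 ^ p.-1 ->
    has_label p.+1 (fun v u => (labels p).2 u v) A y v.

Lemma hard_col_sub p A B r c y :
  sub B A r c -> y < wid B -> hard_col p B y -> hard_col p A (c + y).
Proof.
move=> [h w e] yB [v0 vp hv]; exists v0 => // v /hv [r' r'h hr'].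
exists (r + r'); first by lia.
by move=> u up; rewrite -addnA e ?hr' //; lia.
Qed.

(** Column [y] meets label [y - i] in copy [i]. Left of the centre these labels start at 0;
    otherwise they run from [y.+1 - 2 ^ p] up to the last label. The bounds on [y] leave at least
    [2 ^ p.-1] of them. *)
Lemma hard_col_brick p y : 0 < p -> 2 ^ p.-1 <= y < 3 * 2 ^ p.-1 ->
  hard_col p (brick p) y.
Proof.
move=> p0; have e2 : 2 ^ p = 2 * 2 ^ p.-1 by rewrite -expnS prednK.
have [lh lw] := dim_labels p => hy.
exists (if y < 2 ^ p then 0 else y.+1 - 2 ^ p); first by case: ifP => ?; lia.
move=> v hv; have [vy yv vp] : [/\ v <= y, y - v < 2 ^ p & v < 2 ^ p].
  by move: hv; case: ifP => ?; split; lia.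
have [h1 h2 h3] := sub_labels_shear p yv.
exists ((y - v) * p.+1) => [|u up]; first by rewrite lh in h1.
by rewrite -h3 ?lh ?lw // subnK.
Qed.

(* A brick is only hard in its middle half.  Since [p.+1] is odd, nested strips
   are offset from each other by an odd number of half bricks, so one of the two
   is hit in the middle of a brick. *)
Lemma hard_offsets p y : odd p.+1 -> 0 < p -> thickness p <= y ->
  exists2 d, d = 0 \/ d = thickness p &
    2 ^ p.-1 <= (y - d) %% (2 * 2 ^ p) < 3 * 2 ^ p.-1.
Proof.
move=> op p0; have e0 : 0 < 2 ^ p.-1 by rewrite expn_gt0.
have e2 : 2 ^ p = 2 * 2 ^ p.-1 by rewrite -expnS prednK.
have tE : thickness p = p./2 * (2 * 2 ^ p) + 2 ^ p.
  have := odd_double_half p; rewrite /= in op; rewrite (negbTE op) add0n => ep.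
  by rewrite /thickness -[in p.+1]ep; move: (2 ^ p) => f; nia.
move: tE e0; rewrite e2; move: (2 ^ p.-1) (p./2) => e q tE e0; rewrite {}tE => ty.
have := divn_eq y (2 * (2 * e)); have := @ltn_pmod y (2 * (2 * e)) ltac:(lia).
set y' := y %% _; set m := y %/ _ => ylt ye.
have [h|h] := boolP (e <= y' < 3 * e).
  by exists 0; [left | rewrite subn0].
(* Here [y'] lies in an outer quarter of a brick, and a shift by half a brick moves it into the
   middle half. In the first quarter the subtraction borrows one brick from the quotient. *)
exists (q * (2 * (2 * e)) + 2 * e); first by right.
have [h'|h'] := ltnP y' e.
  have mq : q < m by nia.
  have -> : y - (q * (2 * (2 * e)) + 2 * e) = (m - q.+1) * (2 * (2 * e)) + (y' + 2 * e).
    have [k mk] : exists k, m = k + q.+1 by exists (m - q.+1); lia.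
    by rewrite ye mk addnK; nia.
  by rewrite modnMDl modn_small; lia.
have mq : q <= m by nia.
have -> : y - (q * (2 * (2 * e)) + 2 * e) = (m - q) * (2 * (2 * e)) + (y' - 2 * e).
  have [k mk] : exists k, m = k + q by exists (m - q); lia.
  by rewrite ye mk addnK; nia.
by rewrite modnMDl modn_small; lia.
Qed.

Lemma sub_brick_strip p j m : m < j.+1 * p.+1 ->
  sub (brick p) (strip p j) 0 (m * (2 * 2 ^ p)).
Proof.
move=> mj; rewrite stripE.
have h1 := @sub_hpow _ (hpow (brick p) p) j (m %/ p.+1) ltac:(by rewrite -ltnS ltn_divLR).
have h2 := @sub_hpow _ (brick p) p (m %% p.+1) ltac:(by rewrite -ltnS ltn_mod).
have := sub_trans h2 h1; rewrite wid_hpow (dim_brick p).2.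
rewrite mulnA -mulnDl; congr sub.
by rewrite -divn_eq.
Qed.

Lemma hard_col_strip p j y : 0 < p -> y < wid (strip p j) ->
  2 ^ p.-1 <= y %% (2 * 2 ^ p) < 3 * 2 ^ p.-1 -> hard_col p (strip p j) y.
Proof.
move=> p0; rewrite (dim_strip p j).2 /thickness => yw hy.
have b0 : 0 < 2 * 2 ^ p by rewrite muln_gt0 expn_gt0.
rewrite (divn_eq y (2 * 2 ^ p)).
apply: hard_col_sub (hard_col_brick p0 hy); last by rewrite (dim_brick p).2 ltn_mod.
by apply: sub_brick_strip; rewrite ltn_divLR //; lia.
Qed.

Lemma sub_strip_nest p j : sub (strip p j.+1) (nest p j.+1) 0 0.
Proof. exact: sub_trans (sub_vcatl _ _) (sub_vcatl _ _). Qed.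

Lemma sub_ring_nest p j :
  sub (hcat (hcat (tr (strip p j)) (nest p j)) (tr (strip p j))) (nest p j.+1)
    (thickness p) 0.
Proof.
have [h0 w0] := dim_strip p j; have [h1 w1] := dim_strip p j.+1.
have [hn wn] := dim_nest p j.
have := @sub_vcatr _ (strip p j.+1)
  (hcat (hcat (tr (strip p j)) (nest p j)) (tr (strip p j))) ltac:(rewrite w1 !dimE; lia).
move/(sub_trans (sub_refl _)) => /sub_trans /(_ (sub_vcatl _ (strip p j.+1))).
by rewrite h1 !add0n addn0.
Qed.

Lemma sub_trstrip_nest p j : sub (tr (strip p j)) (nest p j.+1) (thickness p) 0.
Proof.
have := sub_trans (sub_trans (sub_hcatl _ _) (sub_hcatl _ _)) (sub_ring_nest p j).
by rewrite !addn0.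
Qed.

Lemma sub_nest_nest p j : sub (nest p j) (nest p j.+1) (thickness p) (thickness p).
Proof.
have [h0 w0] := dim_strip p j; have [hn wn] := dim_nest p j.
have s := @sub_hcatr _ (tr (strip p j)) (nest p j) ltac:(rewrite !dimE; lia).
have := sub_trans (sub_trans s (sub_hcatl _ _)) (sub_ring_nest p j).
by rewrite !dimE h0 !addn0 add0n.
Qed.

(** The column crosses the top strips of the two outer frames, which start at columns 0 and
    [thickness p]; these are the two offsets of [hard_offsets]. *)
Lemma hard_col_nest p j y : odd p.+1 -> 0 < p ->
  2 * thickness p < y < 2 * thickness p + wid (nest p j) ->
  hard_col p (nest p j.+2) y.
Proof.
move=> op p0; rewrite (dim_nest p j).2 => hy.
have [d [->|->]] := @hard_offsets p y op p0 ltac:(lia).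
  rewrite subn0 => hm.
  have yw : y < wid (strip p j.+2) by rewrite (dim_strip p _).2; nia.
  exact: hard_col_sub (sub_strip_nest p j.+1) yw (hard_col_strip p0 yw hm).
move=> hm.
have yw : y - thickness p < wid (strip p j.+1) by rewrite (dim_strip p _).2; nia.
have := hard_col_sub (sub_trans (sub_strip_nest p j) (sub_nest_nest p j.+1)) yw
  (hard_col_strip p0 yw hm).
by rewrite addn0 subnKC //; lia.
Qed.

(** The left sides of the two outer frames start below the top strips, at rows [thickness p] and
    [2 * thickness p], so [hard_offsets] is applied to [y - thickness p]. *)
Lemma hard_row_nest p j y : odd p.+1 -> 0 < p ->
  2 * thickness p < y < 2 * thickness p + hgt (nest p j) ->
  hard_col p (tr (nest p j.+2)) y.
Proof.
move=> op p0; rewrite (dim_nest p j).1 => hy.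
have [d [->|->]] := @hard_offsets p (y - thickness p) op p0 ltac:(lia).
  rewrite subn0 => hm.
  have yw : y - thickness p < wid (strip p j.+1) by rewrite (dim_strip p _).2; nia.
  have := hard_col_sub (sub_tr (sub_trstrip_nest p j.+1)) yw.
  rewrite trK subnKC; last by lia.
  by apply; apply: hard_col_strip.
move=> hm.
have yw : y - thickness p - thickness p < wid (strip p j).
  by rewrite (dim_strip p _).2; lia.
have := hard_col_sub (sub_tr (sub_trans (sub_trstrip_nest p j) (sub_nest_nest p j.+1))) yw.
rewrite trK -addnA subnKC; last by lia.
rewrite subnKC; last by lia.
by apply; apply: hard_col_strip.
Qed.

Lemma sub_nest_nest2 p j :
  sub (nest p j) (nest p j.+2) (2 * thickness p) (2 * thickness p).
Proof.
have := sub_trans (sub_nest_nest p j) (sub_nest_nest p j.+1).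
by rewrite addnn mul2n.
Qed.

End Construction.

(** * Depth against size *)

Section LowerBound.

Variables (Sigma : Type) (s0 s1 sd : Sigma).
Hypotheses (s01 : s0 <> s1) (s0d : s0 <> sd) (s1d : s1 <> sd).

Local Notation nest := (nest s0 s1 sd).
Local Notation hard_col := (hard_col s0 s1 sd).

Lemma sub_hcat (A B C : str2 Sigma) r c : hgt A = hgt B -> sub C (hcat A B) r c ->
  (c + wid C <= wid A -> sub C A r c) /\ (wid A <= c -> sub C B r (c - wid A)).
Proof.
move=> e [h w s]; rewrite !dimE in h w; split=> cA; split=> [||i j hi hj]; try by lia.
  by rewrite -s //= ifT //; lia.
rewrite -s //= ifF; last by lia.
by congr (B.2 _ _); lia.
Qed.

Lemma hard_col_right p (A B : str2 Sigma) : hgt A = hgt B ->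
  hard_col p (hcat A B) (wid A) -> hard_col p B 0.
Proof.
move=> e [v0 vp h]; exists v0 => // v /h [r rh hr]; exists r; first by rewrite -e.
by move=> u up; rewrite -hr //= ltnn subnn.
Qed.

Section HardEdge.

Variables (rs : seq (rule Sigma)) (p : nat).
Hypotheses (rs_valid : valid rs) (p_gt0 : 0 < p).

Lemma hard_left_edge k A : k < size rs -> expand rs k = Some A ->
  hard_col p A 0 -> 2 ^ p.-1 <= size rs.
Proof.
move=> kn ek [v0 vp h].
apply: (@left_labels_le_size _ sd p.+1 _ v0
  (fun v u => (labels s0 s1 sd p).2 u v)) rs_valid _; first by lia.
- by move=> v hv; apply: labels_head; lia.
- by move=> v u hv hu; apply: labels_tail => //; lia.
- by move=> v v' hv hv'; apply: labels_inj => //; lia.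
- by move=> v hv; exists k, A; split=> //; apply: h.
Qed.

Lemma hard_top_edge k A : k < size rs -> expand rs k = Some A ->
  hard_col p (tr A) 0 -> 2 ^ p.-1 <= size rs.
Proof.
move=> kn ek [v0 vp h].
apply: (@top_labels_le_size _ sd p.+1 _ v0
  (fun v u => (labels s0 s1 sd p).2 u v)) rs_valid _; first by lia.
- by move=> v hv; apply: labels_head; lia.
- by move=> v u hv hu; apply: labels_tail => //; lia.
- by move=> v v' hv hv'; apply: labels_inj => //; lia.
- by move=> v hv; exists k, A; split=> //; apply: h.
Qed.

(* A cut of a nonterminal containing [nest p j.+2] either leaves [nest p j] intact in
   one of the two parts or produces a part with a hard edge.  Hence, unless the
   grammar is large, each level of the derivation sheds at most two layers. *)
Lemma nest_depth_or_size i f k A r c : odd p.+1 ->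
  k < f -> k < size rs -> expand rs k = Some A -> sub (nest p i.*2) A r c ->
  i < depth_f rs f k \/ 2 ^ p.-1 <= size rs.
Proof.
move=> op; elim: i f k A r c => [|i IH] [//|f] k A r c kf kn ek sA.
  by left=> /=; case: nth.
set t := thickness p; have [nh nw] := dim_nest s0 s1 sd p i.*2.
have tn : 0 < t by rewrite muln_gt0 expn_gt0.
rewrite doubleS in sA; have sA' := sub_trans (sub_nest_nest2 s0 s1 sd p i.*2) sA.
have [h2 w2] := dim_nest s0 s1 sd p i.*2.+2.
case: (expandP ek) => [a en eA|l m B C en lk mk el em e eA|l m B C en lk mk el em e eA].
- by case: sA => h _ _; move: h; rewrite h2 -/t eA hgt_cell; nia.
- rewrite /= en; have [sB sC] := sub_hcat e (eq_ind _ (fun X => sub _ X _ _) sA' _ eA).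
  have [hB|hB] := leqP (c + 2 * t + wid (nest p i.*2)) (wid B).
    by have [h|h] := IH f l B _ _ ltac:(lia) ltac:(lia) el (sB hB); [left; lia | right].
  have [hC|hC] := leqP (wid B) (c + 2 * t).
    by have [h|h] := IH f m C _ _ ltac:(lia) ltac:(lia) em (sC hC); [left; lia | right].
  (* The cut is strictly inside the copy of [nest p i.*2], and the left column of [C] is a hard
     column of [A]. *)
  right; apply: (hard_left_edge (leq_ltn_trans (ltnW mk) kn) em).
  apply: (hard_col_right e); rewrite -eA.
  have -> : wid B = c + (wid B - c) by lia.
  apply: hard_col_sub sA _ _; first by rewrite w2 -/t; lia.
  by apply: hard_col_nest => //; rewrite -/t; lia.
(* Transposition reduces a vertical concatenation to the horizontal splitting lemmas. *)
- rewrite /= en; have sA2 := sub_tr (eq_ind _ (fun X => sub _ X _ _) sA' _ eA).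
  have [sB sC] := @sub_hcat (tr B) (tr C) _ _ _ e sA2.
  have [hB|hB] := leqP (r + 2 * t + hgt (nest p i.*2)) (hgt B).
    have := sub_tr (sB hB); rewrite !trK => {}sB.
    by have [h|h] := IH f l B _ _ ltac:(lia) ltac:(lia) el sB; [left; lia | right].
  have [hC|hC] := leqP (hgt B) (r + 2 * t).
    have := sub_tr (sC hC); rewrite !trK => {}sC.
    by have [h|h] := IH f m C _ _ ltac:(lia) ltac:(lia) em sC; [left; lia | right].
  right; apply: (hard_top_edge (leq_ltn_trans (ltnW mk) kn) em).
  apply: (@hard_col_right p (tr B) (tr C) e).
  have -> : hcat (tr B) (tr C) = tr A by rewrite eA.
  have -> : wid (tr B) = r + (hgt B - r) by rewrite dimE; lia.
  apply: hard_col_sub (sub_tr sA) _ _; first by rewrite dimE h2 -/t; lia.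
  by apply: hard_row_nest => //; rewrite -/t; lia.
Qed.

End HardEdge.

Lemma derives_nest p j n : (nest p j).1 = (n, n) ->
  exists2 G : slp Sigma, slp_size G <= 9 + 26 * p + 10 * j &
    derives G (fun (i1 i2 : 'I_n) => (nest p j).2 i1 i2).
Proof.
move=> e; have [rs [v s h]] := gen_nest s0 s1 sd p j.
have [[k kn ek] _] := h _ (or_introl erefl).
exists (SLP rs k) => //; split=> //; exists (nest p j).2; split=> //=.
by rewrite ek -e -surjective_pairing.
Qed.

Lemma derives_depth_or_size p i n (G : slp Sigma) : odd p.+1 -> 0 < p ->
  (nest p i.*2).1 = (n, n) ->
  derives G (fun (i1 i2 : 'I_n) => (nest p i.*2).2 i1 i2) ->
  i < slp_depth G \/ 2 ^ p.-1 <= slp_size G.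
Proof.
move=> op p0 e [[kn v] [A [ek hA]]].
apply: (@nest_depth_or_size (rules G) p v p0 i _ _ _ 0 0 op (ltnSn _) kn ek).
have [eh ew] : hgt (nest p i.*2) = n /\ wid (nest p i.*2) = n by rewrite /hgt /wid e.
split; rewrite ?eh ?ew // => a b an bn.
by rewrite !add0n; apply: (hA (Ordinal an) (Ordinal bn)).
Qed.

End LowerBound.

(** * Logarithms and numerical estimates *)

Lemma INR_exp2 n : INR (2 ^ n) = (2 ^ n)%R.
Proof. by elim: n => [|n IH]; rewrite ?expn0 // expnS mult_INR IH. Qed.

Lemma ln2_gt0 : (0 < ln 2)%R.
Proof. by rewrite -ln_1; apply: ln_increasing; lra. Qed.

Lemma log2_exp2 n : log2 (2 ^ n)%R = INR n.
Proof.
rewrite /log2 ln_pow; last by lra.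
by field; have := ln2_gt0; lra.
Qed.

Lemma log2_le x y : (0 < x <= y)%R -> (log2 x <= log2 y)%R.
Proof.
move=> [x0 xy]; apply: Rmult_le_compat_r.
  by apply/Rlt_le/Rinv_0_lt_compat/ln2_gt0.
by case: (Req_dec x y) => [->|ne]; [right | left; apply: ln_increasing; lra].
Qed.

Lemma log2_bounds n a b : 2 ^ a <= n <= 2 ^ b -> (INR a <= log2 (INR n) <= INR b)%R.
Proof.
case/andP => an nb; rewrite -(log2_exp2 a) -(log2_exp2 b) -!INR_exp2.
have pa : (0 < INR (2 ^ a))%R by rewrite INR_exp2; apply: pow_lt; lra.
have h1 : (INR (2 ^ a) <= INR n)%R by apply/le_INR/leP.
have h2 : (INR n <= INR (2 ^ b))%R by apply/le_INR/leP.
by split; apply: log2_le; lra.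
Qed.

(** With [p = 2 * q], the factor 66 is [2 * 11 * 3], from bounding [(5 * c * q).*2.+1] by
    [11 * (c * q)] and [(2 * q).+1] by [3 * q]. Since [66 * c <= q < 2 ^ q], the polynomial factor
    is at most [2 ^ (3 * q)]. *)
Lemma nest_side_bounds c q : 0 < c -> 66 * c <= q ->
  2 ^ (2 * q) <= 2 * (5 * c * q).*2.+1 * thickness (2 * q) <= 2 ^ (5 * q) /\
  2 * (5 * c * q).*2.+1 * thickness (2 * q) <= 66 * c * q * q * 2 ^ (2 * q).
Proof.
move=> c0 cq; rewrite /thickness.
have qe : q < 2 ^ q by apply: ltn_expl.
have e5 : 2 ^ (5 * q) = 2 ^ q * 2 ^ q * 2 ^ q * 2 ^ (2 * q).
  by rewrite -!expnD; congr (2 ^ _); lia.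
have up : 2 * (5 * c * q).*2.+1 * (2 * q).+1 <= 66 * c * q * q.
  have [h1 h2] : (5 * c * q).*2.+1 <= 11 * (c * q) /\ (2 * q).+1 <= 3 * q.
    by split; nia.
  have := leq_mul h1 h2; lia.
rewrite e5; move: (2 ^ (2 * q)) (2 ^ q) qe => E f qe.
have up' : 66 * c * q * q <= f * f * f.
  by rewrite leq_mul // ?leq_mul //; lia.
split; last by move: (leq_mul up (leqnn E)); lia.
apply/andP; split; first by nia.
by apply: leq_trans (leq_mul up' (leqnn E)); move: (leq_mul up (leqnn E)); lia.
Qed.

Theorem mainTheorem10 (Sigma : finType) (s0 s1 sd : Sigma)
  (Hdist : [/\ s0 != s1, s0 != sd & s1 != sd]) :
  forall c : nat, (1 <= c)%N ->
  exists alpha : R, (0 < alpha)%R /\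
  forall N0 : nat, exists N : nat, (N0 <= N)%N /\
  exists (S : 'I_N -> 'I_N -> Sigma) (G : slp Sigma),
    derives G S /\
    forall G' : slp Sigma, derives G' S ->
      (INR (slp_depth G') >= INR c * log2 (INR N))%R \/
      (INR (slp_size G') >=
         alpha * INR (slp_size G) * INR N / (log2 (INR N)) ^ 3)%R.
Proof.
move=> c c1; have [/eqP s01 /eqP s0d /eqP s1d] := Hdist.
have C1 : (1 <= INR c)%R by apply: (le_INR 1); apply/leP.
(* The bounds below give [g * N <= 161 * 66 * c ^ 2 * q ^ 3 * 2 ^ (2 * q)]. Using
   [2 ^ (2 * q) <= 2 * slp_size G'] and [8 * q ^ 3 <= log2 N ^ 3], the constant becomes 2656.5,
   rounded up to 3000. *)
exists (/ (3000 * INR c ^ 2))%R; split.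
  by apply: Rinv_0_lt_compat; nra.
(* The summand [N0] makes [N] large. As [log2 N <= 5 * q], a depth above [j = 5 * c * q] exceeds
   [c * log2 N]; there are [j.*2] frames because each level sheds two. *)
move=> N0; pose q := N0 + 66 * c; pose j := 5 * c * q.
pose N := 2 * j.*2.+1 * thickness (2 * q).
have [/andP [N_ge N_le] N_le'] := nest_side_bounds c1 (leq_addl N0 (66 * c)).
rewrite -/q -/j -/N in N_ge N_le N_le'.
exists N; split.
  have := ltn_expl (2 * q) (isT : 1 < 2); rewrite /q in N_ge *; lia.
have dimN : (nest s0 s1 sd (2 * q) j.*2).1 = (N, N).
  have [h w] := dim_nest s0 s1 sd (2 * q) j.*2.
  by rewrite [LHS]surjective_pairing -/(hgt _) -/(wid _) h w.
have [G sG dG] := derives_nest dimN.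
exists (fun i1 i2 => (nest s0 s1 sd (2 * q) j.*2).2 i1 i2), G; split=> // G' dG'.
have q1 : 0 < q by rewrite /q; lia.
have op : odd (2 * q).+1 by rewrite mul2n /= odd_double.
have [l1 l2] := log2_bounds (introT andP (conj N_ge N_le)).
have [dep|siz] := derives_depth_or_size s01 s0d s1d op (ltac:(lia) : 0 < 2 * q) dimN dG'.
  left; apply: Rle_ge; apply: Rle_trans (le_INR _ _ (elimT leP (ltnW dep))).
  have -> : INR j = (INR c * INR (5 * q))%R by rewrite -mult_INR; congr INR; rewrite /j; lia.
  by apply: Rmult_le_compat_l => //; lra.
right; apply: Rle_ge.
have Q1 : (1 <= INR q)%R by apply: (le_INR 1); apply/leP.
(* With [p = 2 * q] and [10 * c * q] frames the grammar has at most [9 + 52 * q + 100 * c * q]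
   rules, and [9 + 52 + 100 = 161]. *)
have hG : (INR (slp_size G) <= 161 * INR c * INR q)%R.
  have -> : (161 * INR c * INR q)%R = INR (161 * c * q).
    by rewrite !mult_INR /=; ring.
  by apply/le_INR/leP; apply: leq_trans sG _; rewrite /j; nia.
have hN : (INR N <= 66 * INR c * INR q * INR q * INR (2 ^ (2 * q)))%R.
  have -> : (66 * INR c * INR q * INR q * INR (2 ^ (2 * q)))%R =
      INR (66 * c * q * q * 2 ^ (2 * q)).
    by rewrite !mult_INR /=; ring.
  exact/le_INR/leP.
have hS : (INR (2 ^ (2 * q)) <= 2 * INR (slp_size G'))%R.
  have -> : (2 * INR (slp_size G'))%R = INR (2 * slp_size G') by rewrite mult_INR.
  apply/le_INR/leP; rewrite -[2 * q]prednK ?expnS; last by lia.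
  by rewrite leq_mul2l.
have {l1} l1 : (2 * INR q <= log2 (INR N))%R by move: l1; rewrite mult_INR.
have hl : (8 * INR q ^ 3 <= log2 (INR N) ^ 3)%R.
  have -> : (8 * INR q ^ 3 = (2 * INR q) ^ 3)%R by ring.
  by apply: pow_incr; lra.
have g0 := pos_INR (slp_size G); have n0 := pos_INR N.
have t0 := pos_INR (slp_size G').
have l3 : (0 < log2 (INR N) ^ 3)%R by apply: pow_lt; lra.
have c2 : (0 < 3000 * INR c ^ 2)%R by nra.
apply: (Rmult_le_reg_r (3000 * INR c ^ 2 * log2 (INR N) ^ 3)); first exact: Rmult_lt_0_compat.
have -> : (/ (3000 * INR c ^ 2) * INR (slp_size G) * INR N / log2 (INR N) ^ 3 *
    (3000 * INR c ^ 2 * log2 (INR N) ^ 3) = INR (slp_size G) * INR N)%R.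
  by field; split; lra.
apply: Rle_trans (Rmult_le_compat _ _ _ _ g0 n0 hG hN) _.
have -> : (161 * INR c * INR q * (66 * INR c * INR q * INR q * INR (2 ^ (2 * q))) =
    (10626 * INR c ^ 2 * INR q ^ 3) * INR (2 ^ (2 * q)))%R by ring.
have k0 : (0 <= 10626 * INR c ^ 2 * INR q ^ 3)%R.
  by apply: Rmult_le_pos; [nra | apply: pow_le; lra].
apply: Rle_trans (Rmult_le_compat_l _ _ _ k0 hS) _.
have k1 : (0 <= INR c ^ 2 * INR (slp_size G'))%R by apply: Rmult_le_pos => //; nra.
have := Rmult_le_compat_l _ _ _ k1 hl.
have k2 : (0 <= INR c ^ 2 * INR (slp_size G') * INR q ^ 3)%R.
  by apply: Rmult_le_pos => //; apply: pow_le; lra.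
nra.
Qed.
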